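(* Let $p$ be an odd prime and let $G$ be a finite abelian group such that $p$ divides $|G|$ and $pG\neq\{0\}$. Express $G$ as a direct sum of cyclic groups of prime power order, let $r$ be the number of cyclic summands of $p$-power order and $q$ the number of cyclic summands of $2$-power order, and let $k=|G|/p^r$ (which equals $|pG|$). Then: (1) $\Gamma^+_{G,pG}$ has clique number $k$ and independence number $k(p^r-1)/2+1$; (2) $\Gamma_{G,pG}$ has clique number $k/2+2^{q-1}$, and independence number $k(p^r-1)/2+2$ unless $G\cong C_2^q\times C_p^r$, in which case the independence number is $k(p^r-1)/2+1$.
   Context: Groups are written additively with identity $0$; $C_n$ denotes the cyclic group of order $n$, and $pG=\{pt: t\in G\}$. Cyclic summands are non-trivial. For a finite abelian group $G$ and a subgroup $H$, $\Gamma^+_{G,H}$ is the simple graph with vertex set $G$ in which distinct $x,y$ are adjacent iff $x+y\in H$; $\Gamma_{G,H}$ is the simple graph with vertex set $G$ in which distinct $x,y$ are adjacent iff $x+y\in H\setminus\{0\}$. The clique number is the maximum number of vertices in a complete subgraph, and the independence number is the maximum size of a set of pairwise non-adjacent vertices. *)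

(* Defs.v *)
From HB Require Import structures.
From mathcomp Require Import all_boot all_order all_fingroup all_algebra all_solvable.

Set Implicit Arguments.
Unset Strict Implicit.
Unset Printing Implicit Defensive.

Import GRing.Theory.
Local Open Scope ring_scope.

(* A simple graph on a finite type is a symmetric irreflexive relation. *)
Section Graphs.
Variables (T : finType) (e : rel T).

Definition clique (A : {set T}) : bool :=
  [forall x in A, forall y in A, (x != y) ==> e x y].

Definition independent (A : {set T}) : bool :=
  [forall x in A, forall y in A, (x != y) ==> ~~ e x y].

Definition clique_number : nat := \max_(A : {set T} | clique A) #|A|.

Definition independence_number : nat := \max_(A : {set T} | independent A) #|A|.

End Graphs.

Section SumGraphs.
Variable G : finZmodType.

Definition sum_graph_plus (H : {set G}) : rel G :=
  [rel x y | (x != y) && (x + y \in H)].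

Definition sum_graph (H : {set G}) : rel G :=
  [rel x y | (x != y) && (x + y \in H :\ 0)].

Lemma sum_graph_plus_sym H : symmetric (sum_graph_plus H).
Proof. by move=> x y; rewrite /sum_graph_plus /sum_graph /= eq_sym addrC. Qed.

Lemma sum_graph_plus_irr H : irreflexive (sum_graph_plus H).
Proof. by move=> x; rewrite /sum_graph_plus /sum_graph /= eqxx. Qed.

Lemma sum_graph_sym H : symmetric (sum_graph H).
Proof. by move=> x y; rewrite /sum_graph_plus /sum_graph /= eq_sym addrC. Qed.

Lemma sum_graph_irr H : irreflexive (sum_graph H).
Proof. by move=> x; rewrite /sum_graph_plus /sum_graph /= eqxx. Qed.

End SumGraphs.

Definition nat_multiples (n : nat) (G : finZmodType) : {set G} :=
  [set t *+ n | t in G].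

Lemma nat_multiples_group_set n (G : finZmodType) :
  group_set (nat_multiples n G).
Proof.
apply/group_setP; split=> [|_ _ /imsetP[x _ ->] /imsetP[y _ ->]].
  by apply/imsetP; exists 0; rewrite // mul0rn.
by apply/imsetP; exists (x + y); rewrite // mulrnDl.
Qed.

(* The prime is existentially quantified and the exponent is positive, so a
   summand of order 1 is excluded. *)
Definition prime_power (n : nat) : Prop :=
  exists l e : nat, prime l /\ n = (l ^ e.+1)%N.

(* G is the internal direct sum of the subgroups C i.  The group structure on
   a finZmodType is its additive one (FinRing.zmod_mulgE), so dprod is the
   internal direct sum. *)
Definition primary_cyclic_decomposition (G : finZmodType) (m : nat)
    (C : 'I_m -> {group G}) : Prop :=
  (forall i, cyclic (C i) /\ prime_power #|C i|) /\
  \big[dprod/1%g]_(i < m) (C i : {set G}) = [set: G].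

(* For a summand of a primary cyclic decomposition, being a p-group is having
   order a positive power of p. *)
Definition num_summands (G : finZmodType) (m : nat) (C : 'I_m -> {group G})
    (p : nat) : nat :=
  #|[set i : 'I_m | (p.-group (C i))%g]|.

Definition zmod_isomorphic (U V : zmodType) : Prop :=
  exists f : {additive U -> V}, bijective f.

(* Main.v *)
Require Import Defs.
From HB Require Import structures.
From mathcomp Require Import all_boot all_order all_fingroup all_algebra all_solvable.
From mathcomp Require Import lra.

Import GRing.Theory Num.Theory.
Local Open Scope ring_scope.

Set Implicit Arguments.
Unset Strict Implicit.

(** Write H = pG, of order k and index p^r in G; as p is odd, x + x \in H forces
x \in H.  The vertices of H span a complete graph in the first sum graph.
Outside H every edge joins a coset c to the different coset - c, so the rest is
a disjoint union of bipartite pieces on pairs {c, - c}.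

A clique not contained in H therefore has at most two elements, which settles
the first clique number.  In the second graph the cliques inside H are the
subsets containing at most one element of each pair {x, - x} with x <> - x;
taking exactly one from each, and all the elements of H killed by 2, gives a set
A with A \cup - A = H and A \cap - A = H[2], hence 2 |A| = k + |H[2]|
([clique_number_sum_graph]).

For independent sets, choose one coset of each pair {c, - c}: this gives an
independent set of (|G| - k) / 2 elements outside H ([half_compl]).  It is
optimal in both graphs, since for a nonzero h in H an independent set in the
complement of H is disjoint from its image under the fixed-point-free involution
x |-> h - x of this complement ([card_independent_compl]).  To it one can add one
element of H, or, in the second graph, a pair {h, - h} when some h in H has
h <> - h, and nothing more.

It remains to count.  The numbers of elements killed by p and by 2 are p^r and
2^q by additivity of the rank ([card_torsion]), so |pG| = |G| / p^r, and pG
contains all the elements killed by 2.  Finally pG is killed by 2 exactly when G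
is isomorphic to C_2^q x C_p^r: in this case x |-> (p x, 2 x) embeds G in
G[2] x G[p], with both sides of the same order ([elementary_iff]). *)

(** * Cliques, independent sets and their maximal sizes *)

Lemma cliqueP (T : finType) (e : rel T) (A : {set T}) :
  reflect {in A &, forall x y, x != y -> e x y} (clique e A).
Proof.
apply: (iffP forall_inP) => cA x.
  by move=> y xA yA; have /forall_inP/(_ y yA)/implyP := cA x xA.
by move=> xA; apply/forall_inP=> y yA; apply/implyP; apply: cA.
Qed.

Lemma independentP (T : finType) (e : rel T) (A : {set T}) :
  reflect {in A &, forall x y, x != y -> ~~ e x y} (independent e A).
Proof.
apply: (iffP forall_inP) => cA x.
  by move=> y xA yA; have /forall_inP/(_ y yA)/implyP := cA x xA.
by move=> xA; apply/forall_inP=> y yA; apply/implyP; apply: cA.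
Qed.

Lemma clique_number_eq (T : finType) (e : rel T) (A : {set T}) (n : nat) :
  clique e A -> #|A| = n ->
  (forall B : {set T}, clique e B -> (#|B| <= n)%N) ->
  clique_number e = n.
Proof.
move=> cA cardA maxA; apply/eqP; rewrite eqn_leq; apply/andP; split.
  exact/bigmax_leqP.
by rewrite -cardA; apply: leq_bigmax_cond.
Qed.

Lemma independence_number_eq (T : finType) (e : rel T) (A : {set T}) (n : nat) :
  independent e A -> #|A| = n ->
  (forall B : {set T}, independent e B -> (#|B| <= n)%N) ->
  independence_number e = n.
Proof.
move=> cA cardA maxA; apply/eqP; rewrite eqn_leq; apply/andP; split.
  exact/bigmax_leqP.
by rewrite -cardA; apply: leq_bigmax_cond.
Qed.

(** * Reflections in a finite abelian group *)

(** The elements of [G] annihilated by [n]. *)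
Definition torsion (n : nat) (G : finZmodType) : {set G} :=
  [set x | x *+ n == 0].

(** The image of [A] under the involution x |-> h - x, encoded as a preimage;
for [h = 0] it is - A. *)
Definition reflection (G : finZmodType) (h : G) (A : {set G}) : {set G} :=
  [set x | h - x \in A].

Lemma card_reflection (G : finZmodType) (h : G) (A : {set G}) :
  #|reflection h A| = #|A|.
Proof.
have inj : injective (fun x : G => h - x) by move=> x y /addrI/oppr_inj.
by rewrite -(card_preimset A inj); apply: eq_card => x; rewrite !inE.
Qed.

(** A set disjoint from its reflection fills at most half of any
reflection-stable set containing it. *)
Lemma card_half (G : finZmodType) (h : G) (A B : {set G}) :
  A \subset B -> reflection h B = B -> [disjoint A & reflection h A] ->
  (#|A|.*2 <= #|B|)%N.
Proof.
move=> sAB rB dA; rewrite -addnn -{2}(card_reflection h A).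
move: dA; rewrite -leq_card_setU => /eqP <-; apply: subset_leq_card.
rewrite subUset sAB -rB; apply/subsetP=> x; rewrite !inE.
exact: (subsetP sAB).
Qed.

(** * Sum graphs of a subgroup of odd index *)

(** [H_half] says that the quotient by [H] has no element of order 2. *)
Section SumGraphs.
Variables (G : finZmodType) (H : {set G}).
Hypotheses (H0 : 0 \in H) (HB : {in H &, forall x y, x - y \in H}).
Hypothesis H_half : forall x, x + x \in H -> x \in H.

Let HN x : x \in H -> - x \in H.
Proof. by move=> xH; rewrite -[- x]add0r; apply: HB. Qed.

Let HD x y : x \in H -> y \in H -> x + y \in H.
Proof. by move=> xH yH; rewrite -[y]opprK; apply: HB => //; apply: HN. Qed.

Let HNE x : (- x \in H) = (x \in H).
Proof. by apply/idP/idP => /HN; rewrite ?opprK. Qed.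

Let HDl x y : x \in H -> (x + y \in H) = (y \in H).
Proof.
move=> xH; apply/idP/idP => [xyH|]; last exact: HD.
by rewrite -(addKr x y) HD // HN.
Qed.

Lemma sum_graph_plusE x y :
  sum_graph_plus H x y = (x != y) && (x + y \in H).
Proof. by []. Qed.

Lemma sum_graphE x y :
  sum_graph H x y = [&& x != y, x + y != 0 & x + y \in H].
Proof. by rewrite -in_setD1. Qed.

Lemma sum_graph_sub x y : sum_graph H x y -> sum_graph_plus H x y.
Proof. by rewrite sum_graphE sum_graph_plusE => /and3P[-> _ ->]. Qed.

Lemma clique_sum_graph_plus A :
  clique (sum_graph H) A -> clique (sum_graph_plus H) A.
Proof.
by move/cliqueP=> cA; apply/cliqueP=> x y xA yA /cA/sum_graph_sub; apply.
Qed.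

Lemma independent_sum_graph A :
  independent (sum_graph_plus H) A -> independent (sum_graph H) A.
Proof.
by move/independentP=> cA; apply/independentP=> x y xA yA /cA xy;
  apply: contra (xy xA yA); apply: sum_graph_sub.
Qed.

(** Three pairwise adjacent vertices x, y, z lie in [H], because
2 x = (x + y) + (x + z) - (y + z) does. *)
Lemma clique_sum_graph_plus_dichotomy A :
  clique (sum_graph_plus H) A -> A \subset H \/ (#|A| <= 2)%N.
Proof.
move/cliqueP=> cA; case: (boolP (A \subset H)) => [|/subsetPn[x xA xH]]; first by left.
right; rewrite leqNgt; apply: contra xH; rewrite (cardsD1 x) xA add1n ltnS.
case/card_gt1P=> y [z []]; rewrite !inE => /andP[yx yA] /andP[zx zA] yz.
have sumH u v : u \in A -> v \in A -> u != v -> u + v \in H.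
  by move=> uA vA /(cA _ _ uA vA); rewrite sum_graph_plusE => /andP[].
apply: H_half; have -> : x + x = (x + y) + (x + z) - (y + z).
  by rewrite [x + y + _]addrACA addrK.
by apply: HB; [apply: HD; apply: sumH | apply: sumH]; rewrite // eq_sym.
Qed.

Lemma clique_number_sum_graph_plus :
  (1 < #|H|)%N -> clique_number (sum_graph_plus H) = #|H|.
Proof.
move=> H1; apply: (@clique_number_eq _ _ H) => // [|A /clique_sum_graph_plus_dichotomy].
  by apply/cliqueP=> x y xH yH xy; rewrite sum_graph_plusE xy HD.
by case=> [/subset_leq_card //| /leq_trans]; apply.
Qed.

Lemma reflection_compl h : h \in H -> reflection h (~: H) = ~: H.
Proof. by move=> hH; apply/setP=> x; rewrite !inE HDl // HNE. Qed.

(** One element of each pair {x, - x} of elements of [H]: the one that comes first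
in the enumeration of [G]. *)
Definition half_sub : {set G} :=
  [set x in H | (enum_rank x <= enum_rank (- x))%N].

Lemma half_sub_reflU : half_sub :|: reflection 0 half_sub = H.
Proof.
apply/setP=> x; rewrite !inE sub0r opprK HNE -andb_orr leq_total.
by rewrite andbT.
Qed.

Lemma half_sub_reflI : half_sub :&: reflection 0 half_sub = H :&: torsion 2 G.
Proof.
apply/setP=> x; rewrite !inE sub0r opprK HNE.
case: (x \in H) => //=; rewrite -eqn_leq mulr2n addr_eq0.
by apply/eqP/eqP=> [/ord_inj/enum_rank_inj|<-].
Qed.

Lemma card_half_sub : (#|half_sub|.*2 = #|H| + #|H :&: torsion 2 G|)%N.
Proof.
by rewrite -half_sub_reflI -half_sub_reflU cardsUI card_reflection addnn.
Qed.

Lemma clique_half_sub : clique (sum_graph H) half_sub.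
Proof.
apply/cliqueP=> x y; rewrite !inE => /andP[xH lx] /andP[yH ly] xy.
rewrite sum_graphE xy HD // andbT /=; apply: contra xy; rewrite addr_eq0 => /eqP xNy.
apply/eqP/enum_rank_inj/ord_inj/eqP.
by rewrite -xNy in ly; rewrite xNy opprK -xNy in lx; rewrite eqn_leq lx ly.
Qed.

Lemma clique_number_sum_graph :
  (1 < #|H|)%N ->
  ((clique_number (sum_graph H)).*2 = #|H| + #|H :&: torsion 2 G|)%N.
Proof.
move=> H1; rewrite -card_half_sub; congr _.*2.
apply: (clique_number_eq clique_half_sub) => // A cA.
rewrite -leq_double card_half_sub.
have tors0 : 0 \in H :&: torsion 2 G by rewrite !inE H0 mul0rn eqxx.
case: (clique_sum_graph_plus_dichotomy (clique_sum_graph_plus cA)) => [sAH|A2].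
  rewrite -addnn -{2}(card_reflection 0 A) -cardsUI leq_add //.
    apply: subset_leq_card; rewrite subUset sAH; apply/subsetP=> x; rewrite !inE sub0r.
    by move/(subsetP sAH); rewrite HNE.
  apply: subset_leq_card; apply/subsetP=> x; rewrite !inE sub0r => /andP[xA NxA].
  rewrite (subsetP sAH) //= mulr2n addr_eq0; apply: contraT => xNx.
  by move/cliqueP: cA => /(_ _ _ xA NxA xNx); rewrite sum_graphE subrr eqxx andbF.
(* A clique not contained in [H] has at most two elements.  The bound is at least
   four: either [H] has at least three elements, and 0 is killed by 2, or [H] has
   exactly two and is annihilated by 2. *)
apply: (@leq_trans 4); first by rewrite (leq_double _ 2).
have [H2 | H2] := ltnP 2 #|H|.
  by apply: (@leq_add 3 1) => //; apply/card_gt0P; exists 0.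
have cH : #|H| = 2%N by apply/eqP; rewrite eqn_leq H2 H1.
have : H \subset torsion 2 G.
  apply/subsetP=> x xH; rewrite !inE mulr2n; apply: contraT => xx.
  have x0 : x != 0 by apply: contra xx => /eqP->; rewrite addr0.
  (* Otherwise 0, x and x + x would be three distinct elements of [H]. *)
  have : (#|[set 0%R; x; (x + x)%R]| <= #|H|)%N.
    apply: subset_leq_card; apply/subsetP=> y; rewrite !inE.
    by case/orP=> [/orP[]|] /eqP->; rewrite ?HD.
  have xxx : (x + x == x) = false by rewrite -subr_eq0 addrK (negPf x0).
  by rewrite cH setUC cardsU1 !inE (negPf xx) xxx cards2 eq_sym x0.
by move/setIidPl=> ->; rewrite cH.
Qed.

(** A numbering of the cosets of [H], [set y | x - y \in H] being the coset of x. *)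
Definition coset_rank (x : G) : nat := enum_rank [set y | x - y \in H].

Lemma coset_rankP x y : reflect (coset_rank x = coset_rank y) (x - y \in H).
Proof.
apply: (iffP idP) => [xyH | /ord_inj/enum_rank_inj/setP/(_ y)]; last first.
  by rewrite !inE subrr H0.
congr (nat_of_ord (enum_rank _)); apply/setP=> z; rewrite !inE.
by rewrite -[x](subrK y) -addrA (HDl _ xyH).
Qed.

(** The union of the cosets numbered before their opposite: one coset of each pair
{c, - c} with c <> H. *)
Definition half_compl : {set G} := [set x | (coset_rank x < coset_rank (- x))%N].

Lemma half_compl_notin x : x \in half_compl -> x \notin H.
Proof.
rewrite inE => lx; apply/negP=> xH.
suff /coset_rankP E : x - - x \in H by rewrite E ltnn in lx.
by rewrite opprK HD.
Qed.

Lemma half_compl_reflU : half_compl :|: reflection 0 half_compl = ~: H.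
Proof.
apply/setP=> x; rewrite !inE sub0r opprK.
case: ltngtP => [lx|lx|E] /=.
- by apply/esym/half_compl_notin; rewrite inE.
- by rewrite -HNE; apply/esym/half_compl_notin; rewrite inE opprK.
- by apply/esym/negbTE; rewrite negbK H_half // -[X in _ + X]opprK; apply/coset_rankP.
Qed.

Lemma half_compl_reflI : [disjoint half_compl & reflection 0 half_compl].
Proof.
rewrite -setI_eq0; apply/eqP/setP=> x; rewrite !inE sub0r opprK.
by case: ltngtP.
Qed.

Lemma card_half_compl : #|half_compl|.*2 = #|~: H|.
Proof.
rewrite -half_compl_reflU; move: half_compl_reflI; rewrite -leq_card_setU.
by move/eqP=> ->; rewrite card_reflection addnn.
Qed.

Lemma half_compl_add x y :
  x \in half_compl -> y \in half_compl -> x + y \notin H.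
Proof.
rewrite !inE => lx ly; apply/negP=> xyH.
have E1 : coset_rank x = coset_rank (- y) by apply/coset_rankP; rewrite opprK.
have E2 : coset_rank y = coset_rank (- x).
  by apply/coset_rankP; rewrite opprK addrC.
by rewrite -E1 E2 ltnNge ltnW in ly.
Qed.

(** No edge with its sum in [H] lies inside [half_compl] or joins it to [H]. *)
Lemma independent_half_compl (e : rel G) (B : {set G}) :
  (forall x y, e x y -> x + y \in H) -> B \subset H -> independent e B ->
  independent e (half_compl :|: B).
Proof.
move=> eH sBH /independentP iB; apply/independentP=> x y.
have notinD u v : u \in half_compl -> v \in B -> u + v \notin H.
  by move=> /half_compl_notin uH /(subsetP sBH) vH; rewrite addrC HDl.
rewrite !in_setU => /orP[] xS /orP[] yS xy.
- by apply: contra (half_compl_add xS yS); apply: eH.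
- by apply: contra (notinD x y xS yS); apply: eH.
- by apply: contra (notinD y x yS xS); rewrite addrC; apply: eH.
- exact: iB.
Qed.

Lemma card_half_complU (B : {set G}) :
  B \subset H -> (#|half_compl :|: B|.*2 = #|~: H| + #|B|.*2)%N.
Proof.
move=> sBH; rewrite -card_half_compl -doubleD; congr _.*2.
apply/eqP; rewrite (leq_card_setU _ _) disjoint_sym.
by rewrite disjoints_subset; apply/subsetP=> x /(subsetP sBH) xH; rewrite inE;
  apply: contraL xH; apply: half_compl_notin.
Qed.

(** For nonzero [h] in [H], the points x and h - x outside [H] are distinct and
adjacent, so they are not both in [A]. *)
Lemma card_independent_compl (A : {set G}) :
  (1 < #|H|)%N -> independent (sum_graph H) A -> (#|A :\: H|.*2 <= #|~: H|)%N.
Proof.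
rewrite (cardsD1 0) H0 add1n ltnS => /card_gt0P[h]; rewrite !inE.
case/andP=> h0 hH /independentP iA; apply: (card_half _ (reflection_compl hH)).
  by rewrite setDE subsetIr.
rewrite -setI_eq0; apply/eqP/setP=> x; rewrite !inE.
apply/negP => /andP[/andP[xH xA] /andP[_ hxA]].
have xhx : x != h - x.
  by apply: contra xH; rewrite eq_sym subr_eq => /eqP hE; rewrite H_half -?hE.
by have := iA _ _ xA hxA xhx; rewrite sum_graphE xhx addrC subrK h0 hH.
Qed.

Lemma independence_number_sum_graph_plus :
  (1 < #|H|)%N ->
  ((independence_number (sum_graph_plus H)).*2 = #|~: H| + 2)%N.
Proof.
move=> H1; have s0H : [set 0] \subset H by rewrite sub1set.
have i0 : independent (sum_graph_plus H) [set 0].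
  by apply/independentP=> x y; rewrite !inE => /eqP-> /eqP->; rewrite eqxx.
have -> : 2%N = #|[set (0 : G)]|.*2 by rewrite cards1.
rewrite -card_half_complU //; congr _.*2.
apply: (independence_number_eq (independent_half_compl _ s0H i0)) => // [x y|A iA].
  by rewrite sum_graph_plusE => /andP[].
rewrite -leq_double card_half_complU // cards1 -(cardsID H A) doubleD addnC leq_add //.
  exact/card_independent_compl/independent_sum_graph.
rewrite leq_double; apply/card_le1P => x /setIP[xA xH] y.
apply/idP/idP => [/setIP[yA yH]|/eqP->]; last by rewrite inE xA.
rewrite inE; apply: contraT => yx.
by move/independentP: iA => /(_ y x yA xA yx); rewrite sum_graph_plusE yx HD.
Qed.

Lemma independence_number_sum_graph :
  (1 < #|H|)%N ->
  ((independence_number (sum_graph H)).*2 =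
     #|~: H| + (if H \subset torsion 2 G then 2 else 4))%N.
Proof.
move=> H1; have eH x y : sum_graph H x y -> x + y \in H.
  by rewrite sum_graphE => /and3P[].
(* The only element of [H] not adjacent to x, besides x, is - x. *)
have pair A x y : independent (sum_graph H) A -> x \in A :&: H -> y \in A :&: H ->
    x != y -> y = - x.
  move=> /independentP iA /setIP[xA xH] /setIP[yA yH] xy; apply/eqP.
  have := iA x y xA yA xy.
  by rewrite sum_graphE xy HD // andbT negbK addrC addr_eq0.
case: ifPn => [sHt | /subsetPn[h hH]].
  have s0H : [set 0] \subset H by rewrite sub1set.
  have i0 : independent (sum_graph H) [set 0].
    by apply/independentP=> x y; rewrite !inE => /eqP-> /eqP->; rewrite eqxx.
  have -> : 2%N = #|[set (0 : G)]|.*2 by rewrite cards1.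
rewrite -card_half_complU //; congr _.*2.
  apply: (independence_number_eq (independent_half_compl eH s0H i0)) => // A iA.
  rewrite -leq_double card_half_complU // cards1 -(cardsID H A) doubleD addnC leq_add //.
    exact: card_independent_compl.
  rewrite leq_double; apply/card_le1P => x xAH y.
  apply/idP/idP => [yAH|/eqP-> //]; rewrite inE; apply: contraT => yx.
  have xE := pair A y x iA yAH xAH yx.
  move/setIP: yAH => [_ /(subsetP sHt)]; rewrite inE mulr2n addr_eq0 -xE.
  by rewrite (negPf yx).
rewrite inE mulr2n addr_eq0 => hNh.
have sBH : [set h; - h] \subset H.
  by apply/subsetP=> x; rewrite !inE => /orP[] /eqP->; rewrite ?HNE.
have iB : independent (sum_graph H) [set h; - h].
  apply/independentP=> x y; rewrite !inE sum_graphE.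
  by case/orP=> /eqP-> /orP[] /eqP->; rewrite ?eqxx ?subrr ?addNr ?eqxx ?andbF.
have -> : 4%N = #|[set h; - h]|.*2 by rewrite cards2 hNh.
rewrite -card_half_complU //; congr _.*2.
apply: (independence_number_eq (independent_half_compl eH sBH iB)) => // A iA.
rewrite -leq_double card_half_complU // cards2 hNh -(cardsID H A) doubleD addnC leq_add //.
  exact: card_independent_compl.
rewrite leq_double; have [->|[x xAH]] := set_0Vmem (A :&: H); first by rewrite cards0.
apply: (@leq_trans #|[set x; - x]|); last by rewrite cards2; case: (x != _).
apply: subset_leq_card; apply/subsetP=> y yAH; rewrite !inE.
case: (eqVneq y x) => //= yx; apply/eqP; apply: pair iA xAH yAH _.
by rewrite eq_sym.
Qed.

End SumGraphs.

(** * Counting torsion elements and multiples *)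

Lemma zmod_expgE (G : finZmodType) (x : G) (n : nat) : (x ^+ n)%g = x *+ n.
Proof. by elim: n => // n IHn; rewrite expgS mulrS IHn. Qed.

Lemma zmod_abelian (G : finZmodType) (A : {set G}) : abelian A.
Proof. by apply/centsP=> x _ y _; apply: addrC. Qed.

Lemma torsion_group_set (n : nat) (G : finZmodType) : group_set (torsion n G).
Proof.
apply/group_setP; split=> [|x y]; first by rewrite inE mul0rn.
by rewrite !inE mulrnDl => /eqP-> /eqP->; rewrite addr0.
Qed.

Lemma abelem_torsion (n : nat) (G : finZmodType) (A : {group G}) :
  prime n -> (n.-abelem A)%g = (A \subset torsion n G).
Proof.
move=> n_pr; rewrite abelemE // zmod_abelian /= -sub_Ldiv.
apply/subsetP/subsetP => sA x xA; have := sA x xA; rewrite !inE zmod_expgE.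
  by case/andP.
by rewrite xA.
Qed.

(** The n-torsion is the largest elementary abelian n-subgroup. *)
Lemma card_torsion_rank (n : nat) (G : finZmodType) :
  prime n -> #|torsion n G| = (n ^ 'r_n([set: G])%g)%N.
Proof.
move=> n_pr; pose T := Group (torsion_group_set n G).
have abT : (n.-abelem T)%g by rewrite abelem_torsion.
have pT : (n.-group T)%g by apply: abelem_pgroup abT.
rewrite -[torsion n G]/(T : {set G}) (card_pgroup pT); congr expn.
apply/eqP; rewrite eqn_leq logn_le_p_rank /=; last first.
  by apply/pElemP; rewrite subsetT.
have [E /pnElemP[_ abE <-]] := p_rank_witness n [set: G]%G.
by apply: (@lognSg _ n E T); rewrite -abelem_torsion.
Qed.

(** The n-rank of a nontrivial cyclic group of prime power order is 1 if it is an
n-group and 0 otherwise. *)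
Lemma p_rank_prime_power_cyclic (gT : finGroupType) (A : {group gT}) (n : nat) :
  prime n -> cyclic A -> prime_power #|A| -> 'r_n(A)%g = (n.-group A)%g :> nat.
Proof.
move=> n_pr cA [l [e [l_pr cardA]]].
have := p_rank_le_rank n A.
have := cA; rewrite abelian_rank1_cyclic ?cyclic_abelian // => r1 /leq_trans/(_ r1).
rewrite /pgroup cardA pnatX orbF (pnatE _ l_pr) /= inE.
have := p_rank_gt0 n A; rewrite /= cardA pi_of_exp // (pi_of_prime l_pr) inE eq_sym => <-.
by case: ('r_n(A)%g) => [|[]].
Qed.

Lemma card_torsion (n m : nat) (G : finZmodType) (C : 'I_m -> {group G}) :
  prime n -> primary_cyclic_decomposition C ->
  #|torsion n G| = (n ^ num_summands C n)%N.
Proof.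
move=> n_pr [cC dC]; rewrite card_torsion_rank //; congr expn.
have rankC (s : seq 'I_m) (D : {group G}) :
    \big[dprod/1%g]_(i <- s) (C i : {set G}) = D ->
    'r_n(D)%g = (\sum_(i <- s) (n.-group (C i))%g)%N.
  elim: s D => [|i s IHs] D; first by rewrite !big_nil => <-; rewrite p_rank1.
  rewrite !big_cons => dD; have [[_ K _ defK] _ _ _] := dprodP dD.
  rewrite -(IHs _ defK) -(p_rank_prime_power_cyclic n_pr (cC i).1 (cC i).2).
    by rewrite defK in dD; rewrite (p_rank_dprod n dD).
rewrite (rankC _ [set: G]%G dC) /num_summands -sum1dep_card [RHS]big_mkcond.
by apply: eq_bigr => i _; case: (n.-group _)%g.
Qed.

(** The first isomorphism theorem for multiplication by [n]. *)
Lemma card_multiples_torsion (n : nat) (G : finZmodType) :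
  #|G| = (#|nat_multiples n G| * #|torsion n G|)%N.
Proof.
have fM : {in [set: G] &, {morph (fun x : G => x *+ n : G) : x y / (x * y)%g}}.
  by move=> x y _ _; apply: mulrnDl.
pose f := Morphism fM.
have -> : nat_multiples n G = (f @* [set: G])%g.
  by rewrite morphimEdom; apply/setP=> y; apply/imsetP/imsetP=> [] [t _ ->]; exists t.
have -> : torsion n G = ('ker f)%g.
  by apply/setP=> x; rewrite !inE.
rewrite -[LHS]cardsT -(Lagrange (subsetT ('ker f)%G)) mulnC; congr muln.
by rewrite card_morphim setIid.
Qed.

(** * The elementary case *)

Lemma card_rV_Zp (n s : nat) : (1 < n)%N -> #|{: 'rV['Z_n]_s}| = (n ^ s)%N.
Proof. by move=> n1; rewrite card_mx card_ord mul1n Zp_cast. Qed.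

Lemma rV_Zp_mulrn (n s : nat) (u : 'rV['Z_n]_s) : (1 < n)%N -> u *+ n = 0.
Proof.
by move=> n1; apply/rowP=> i; rewrite mulmxnE mxE -mulr_natr pchar_Zp // mulr0.
Qed.

(** An elementary abelian subgroup is isomorphic to a space of row vectors; the
isomorphism is given as a function on [G] that is meaningful on [A] only. *)
Lemma elementary_embedding (n s : nat) (G : finZmodType) (A : {group G}) :
  prime n -> A \subset torsion n G -> #|A| = (n ^ s)%N ->
  exists f : G -> 'rV['Z_n]_s,
    {in A &, {morph f : x y / x + y}} /\ {in A &, injective f}.
Proof.
move=> n_pr; rewrite -abelem_torsion // => abA cardA.
have n1 := prime_gt1 n_pr.
have: (A \isog [set: 'rV['Z_n]_s])%g.
  rewrite (isog_abelem_card _ abA) cardsT card_rV_Zp // cardA eqxx andbT.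
  rewrite abelem_torsion //; apply/subsetP=> u _.
  by rewrite inE rV_Zp_mulrn.
case/isogP=> f injf _; exists f; split; last exact/injmP.
by move=> x y xA yA; apply: morphM.
Qed.

(** With this identity an odd [p] acts on 2-torsion as 1, and [x] is determined by
2 x and p x. *)
Lemma odd_mulrn (V : zmodType) (p : nat) (x : V) :
  odd p -> x *+ p = x *+ 2 *+ p./2 + x.
Proof.
by move=> odd_p; rewrite -{1}(odd_double_half p) odd_p add1n mulrSr -muln2 mulnC mulrnA.
Qed.

Lemma torsion2_sub_multiples (p : nat) (G : finZmodType) :
  odd p -> torsion 2 G \subset nat_multiples p G.
Proof.
move=> odd_p; apply/subsetP=> x; rewrite inE => /eqP x2; apply/imsetP; exists x => //.
by rewrite odd_mulrn // x2 mul0rn add0r.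
Qed.

Lemma multiples_half (p : nat) (G : finZmodType) (x : G) :
  odd p -> x + x \in nat_multiples p G -> x \in nat_multiples p G.
Proof.
move=> odd_p /imsetP[t _ xx]; apply/imsetP; exists (x - t *+ p./2) => //.
by rewrite mulrnBl odd_mulrn // mulr2n xx -!mulrnA mulnC addrAC subrr add0r.
Qed.

Lemma multiplesB (n : nat) (G : finZmodType) :
  {in nat_multiples n G &, forall x y, x - y \in nat_multiples n G}.
Proof.
move=> _ _ /imsetP[t _ ->] /imsetP[u _ ->]; apply/imsetP; exists (t - u) => //.
by rewrite mulrnBl.
Qed.

(** The multiples of [p] are annihilated by 2 iff [G] is elementary. *)
Lemma elementary_iff (p q r : nat) (G : finZmodType) :
  prime p -> odd p ->
  #|torsion 2 G| = (2 ^ q)%N -> #|torsion p G| = (p ^ r)%N ->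
  zmod_isomorphic G ('rV['Z_2]_q * 'rV['Z_p]_r)%type <->
    nat_multiples p G \subset torsion 2 G.
Proof.
move=> p_pr odd_p card2 cardp; have p1 := prime_gt1 p_pr; split=> [[f bij_f]|sub2].
  apply/subsetP=> _ /imsetP[t _ ->]; rewrite inE; apply/eqP/(bij_inj bij_f).
  rewrite !raddfMn raddf0; case: (f t) => u v; rewrite !pairMnE /=.
  by rewrite (rV_Zp_mulrn v) // mul0rn rV_Zp_mulrn.
have subp (x : G) : x *+ 2 \in torsion p G.
  rewrite inE -mulrnA mulnC mulrnA.
  by have /(subsetP sub2) : x *+ p \in nat_multiples p G; [apply: imset_f | rewrite inE].
have in2 (x : G) : x *+ p \in torsion 2 G by apply: (subsetP sub2); apply: imset_f.
have [f [fD f_inj]] := elementary_embedding (A := Group (torsion_group_set 2 G))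
  (isT : prime 2) (subxx _) card2.
have [g [gD g_inj]] := elementary_embedding (A := Group (torsion_group_set p G))
  p_pr (subxx _) cardp.
(* [h] is the map x |-> (p x, 2 x) into the product of the torsion subgroups. *)
pose h x := (f (x *+ p), g (x *+ 2)).
have hB : nmod_morphism h.
  have hD : {morph h : x y / x + y}.
    by move=> x y; rewrite /h !mulrnDl fD // gD.
  by split=> //; apply: (addrI (h 0)); rewrite -hD !addr0.
have leVG : (#|{: 'rV['Z_2]_q * 'rV['Z_p]_r}| <= #|G|)%N.
  rewrite card_prod (card_rV_Zp q (isT : (1 < 2)%N)) (card_rV_Zp r p1) -card2 -cardp.
  rewrite (card_multiples_torsion p G) leq_mul2r.
  by rewrite (subset_leq_card (torsion2_sub_multiples G odd_p)) orbT.
have h_inj : injective h.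
  move=> x y [/f_inj xyp /g_inj xy2]; have := xyp (in2 x) (in2 y).
  by rewrite (odd_mulrn x odd_p) (odd_mulrn y odd_p) xy2 // => /addrI; apply.
pose hA : {additive G -> _} := HB.pack h (GRing.isNmodMorphism.Build _ _ h hB).
by exists hA; apply: (inj_card_bij h_inj leVG).
Qed.

(** * The clique and independence numbers *)

Unset Implicit Arguments.
Set Strict Implicit.

Theorem mainTheorem6 (p : nat) (G : finZmodType) (m : nat)
    (C : 'I_m -> {group G}) :
  prime p -> odd p ->
  (p %| #|G|)%N ->
  nat_multiples p G <> [set 0] ->
  primary_cyclic_decomposition C ->
  let r : nat := num_summands C p in
  let q : nat := num_summands C 2 in
  let k : rat := #|G|%:R / p%:R ^+ r in
  let pG : {set G} := nat_multiples p G in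
  let elementary : Prop :=
    zmod_isomorphic G ('rV['Z_2]_q * 'rV['Z_p]_r)%type in
  k = #|pG|%:R /\
  ((clique_number (sum_graph_plus pG))%:R = k /\
   (independence_number (sum_graph_plus pG))%:R
     = k * (p%:R ^+ r - 1) / 2%:R + 1) /\
  ((clique_number (sum_graph pG))%:R = k / 2%:R + 2%:R ^ (q%:Z - 1) /\
   (~ elementary ->
      (independence_number (sum_graph pG))%:R
        = k * (p%:R ^+ r - 1) / 2%:R + 2%:R) /\
   (elementary ->
      (independence_number (sum_graph pG))%:R
        = k * (p%:R ^+ r - 1) / 2%:R + 1)).
Proof.
move=> p_pr odd_p _ pG_neq0 dC r q k pG elementary.
have card2 : #|torsion 2 G| = (2 ^ q)%N by apply: card_torsion dC.
have cardp : #|torsion p G| = (p ^ r)%N by apply: card_torsion dC.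
have cardG : #|G| = (#|pG| * p ^ r)%N by rewrite -cardp; apply: card_multiples_torsion.
have pG0 : 0 \in pG by apply/imsetP; exists 0; rewrite ?mul0rn.
have pGB := @multiplesB p G; have pG_half x := @multiples_half p G x odd_p.
have pG_gt1 : (1 < #|pG|)%N.
  rewrite ltnNge; apply/negP=> /card_le1_eqP pG1; apply: pG_neq0.
  apply/setP=> x; rewrite inE; apply/idP/eqP=> [xpG|->] //; exact: pG1.
have P_neq0 : p%:R ^+ r != 0 :> rat.
  by rewrite expf_neq0 // pnatr_eq0 -lt0n prime_gt0.
have kE : k = #|pG|%:R by rewrite /k cardG natrM natrX mulfK.
have cardC : (#|pG| + #|~: pG| = #|pG| * p ^ r)%N by rewrite cardsC.
have {}cardC : #|~: pG|%:R = k * (p%:R ^+ r - 1).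
  move/(congr1 (fun n => n%:R : rat)): cardC.
  by rewrite natrD natrM natrX -kE mulrBr mulr1 => <-; rewrite addrC addKr.
(* The independence numbers are computed doubled, to avoid halving in nat. *)
have dbl (n s : nat) : (n.*2 = #|~: pG| + s)%N ->
    n%:R = k * (p%:R ^+ r - 1) / 2%:R + s%:R / 2%:R :> rat.
  move/(congr1 (fun n => n%:R : rat)); rewrite -muln2 natrM natrD cardC; lra.
have ind := independence_number_sum_graph pG0 pGB pG_half pG_gt1.
have elemP : elementary <-> pG \subset torsion 2 G by apply: elementary_iff.
split=> //; split; split.
- by rewrite clique_number_sum_graph_plus.
- rewrite (dbl _ _ (independence_number_sum_graph_plus pG0 pGB pG_half pG_gt1)).
  by rewrite divff.
- have := clique_number_sum_graph pG0 pGB pG_half pG_gt1.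
  rewrite (setIidPr (torsion2_sub_multiples G odd_p)) card2.
  move/(congr1 (fun n => n%:R : rat)); rewrite -muln2 natrM natrD natrX -kE.
  rewrite expfzDr // exprN1; set x := 2%:R ^ _; have -> : 2%:R ^+ q = x by [].
  lra.
- split=> [nel | /elemP sub2]; last by rewrite sub2 in ind; rewrite (dbl _ _ ind) divff.
  rewrite ifN in ind; last by apply/negP=> /elemP.
  rewrite (dbl _ _ ind); congr (_ + _); lra.
Qed.
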